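(* Let $\phi:\mathbb{R}\to\mathbb{R}$ be a real-valued, even Schwartz function, and let $t_0\in\mathbb{R}$ and $Y>0$. In the symmetrically paired finite sum over the zeros in $\mathcal{Z}_Y$, the contribution of every off-critical pair $\{\rho,\,1-\overline{\rho}\}$ to $M_Y''(1/2;t_0,\phi)$ is zero. Zeros on the critical line contribute no term in the paired formula away from their singular ordinates.
   Context: $\Xi(s)=\tfrac12 s(s-1)\pi^{-s/2}\Gamma(s/2)\zeta(s)$ is the completed Riemann zeta function, an entire function with $\Xi(s)=\Xi(1-s)$ and $\Xi(\overline s)=\overline{\Xi(s)}$, so that its zero set is symmetric under conjugation and under $\rho\mapsto 1-\overline\rho$. For $Y>0$ let $\mathcal{Z}_Y=\{\rho=\beta+i\gamma:\Xi(\rho)=0,\ |\gamma|\le Y\}$, with multiplicities, let $R_Y(s)=\sum_{\rho\in\mathcal{Z}_Y}\frac1{s-\rho}$, and $$M_Y(\sigma;t_0,\phi)=\int_{\mathbb{R}}\phi(t-t_0)\operatorname{Re}R_Y(\sigma+it)\,dt ,$$ with $M_Y''$ the second derivative in $\sigma$. If the vertical set $\{\sigma+it: t\in\operatorname{supp}\phi(\cdot-t_0)\}$ contains no zero in $\mathcal{Z}_Y$, then $$M_Y''(\sigma;t_0,\phi)=\sum_{\rho\in\mathcal{Z}_Y}\operatorname{Re}\int_{\mathbb{R}}\frac{2\phi(t-t_0)}{(\sigma+it-\rho)^3}\,dt ,$$ and the contribution of a zero $\rho$ with $\operatorname{Re}\rho\ne\sigma$ means the corresponding term of this sum. The symmetrically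 paired finite sum (the paired formula) is this sum with each zero $\rho=\beta+i\gamma$ grouped with its reflection $1-\overline\rho=(1-\beta)+i\gamma$ in the critical line $\operatorname{Re}(s)=1/2$. A pair is off-critical if $\beta\ne1/2$. The singular ordinate of a critical-line zero $\rho=1/2+i\gamma$ is $t=\gamma$, where $1/2+it-\rho$ vanishes. *)

(* Defs.v *)
From HB Require Import structures.
From mathcomp Require Import all_boot all_order all_algebra.
From mathcomp Require Import all_classical all_reals all_analysis.
From mathcomp Require Import complex.
Import Order.TTheory GRing.Theory Num.Theory.
Import numFieldNormedType.Exports.
Import complex.

Set Implicit Arguments.
Unset Strict Implicit.
Unset Printing Implicit Defensive.

Local Open Scope classical_set_scope.
Local Open Scope ring_scope.
Local Open Scope complex_scope.

Section CompletedZeta.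
Context {R : realType}.
Implicit Types (s rho : R[i]) (f Xi : R[i] -> R[i]).

(* Complex-valued Lebesgue integral over the real line, taken componentwise. *)
Definition cintegral (A : set R) (f : R -> R[i]) : R[i] :=
  (\int[lebesgue_measure]_(t in A) Re (f t))%R +i*
  (\int[lebesgue_measure]_(t in A) Im (f t))%R.

(* x ^ s = exp (s ln x), meant for x > 0. *)
Definition cpowr (x : R) s : R[i] :=
  (expR (Re s * ln x))%:C *
  (cos (Im s * ln x) +i* sin (Im s * ln x)).

(* Euler's integral, meant for Re s > 0. *)
Definition Gamma s : R[i] :=
  cintegral `]0, +oo[ (fun x => cpowr x (s - 1) * (expR (- x))%:C).

(* The Dirichlet series, meant for Re s > 1. *)
Definition zeta s : R[i] :=
  lim (series (fun n : nat => cpowr n.+1%:R (- s) : R[i]^o) @ \oo).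

Definition entire f : Prop :=
  forall s, derivable (f : R[i]^o -> R[i]^o) s 1.

(* By the identity theorem at most one entire function satisfies the formula on
   the half-plane Re s > 1, where Gamma and zeta are given by the convergent
   integral and series above; this is the usual analytic continuation. *)
Definition completed_zeta Xi : Prop :=
  entire Xi /\
  forall s, 1 < Re s ->
    Xi s = 2^-1 * s * (s - 1) * cpowr pi (- (s / 2)) * Gamma (s / 2) * zeta s.

Definition has_order f rho (n : nat) : Prop :=
  exists g : R[i]^o -> R[i]^o,
    [/\ (\forall s \near (rho : R[i]^o), derivable g s 1),
        g rho != 0 &
        \forall s \near (rho : R[i]^o), f s = (s - rho) ^+ n * g s].

(* The default 0 is never used for a function that is not locally zero. *)
Definition mult f rho : nat := xget 0%N [set n | has_order f rho n].

Definition zeros Xi (Y : R) : set R[i] :=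
  [set rho | Xi rho = 0 /\ `|Im rho| <= Y].

End CompletedZeta.

Section SecondDerivative.
Context {R : realType}.
Implicit Types (phi : R -> R) (rho : R[i]) (A : set R) (sigma t Y : R).

Definition schwartz phi : Prop :=
  (forall n x, derivable (derive1n n phi) x 1) /\
  (forall k n : nat, exists C : R, forall x, `|x ^+ k * derive1n n phi x| <= C).

Definition translate phi t0 : R -> R := fun t => phi (t - t0).

Definition supp (f : R -> R) : set R := closure [set t | f t != 0].

Variable Xi : R[i] -> R[i].

Definition RY Y (s : R[i]) : R[i] :=
  \sum_(rho \in zeros Xi Y) ((mult Xi rho)%:R / (s - rho)).

Definition MY Y phi t0 : R -> R := fun sigma =>
  (\int[lebesgue_measure]_(t in setT)
     (translate phi t0 t * Re (RY Y (sigma +i* t))))%R.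

(* The summand of M_Y'' attached to one occurrence of rho. *)
Definition term_integrand phi t0 sigma rho t : R[i] :=
  (2 * translate phi t0 t)%:C / ((sigma +i* t) - rho) ^+ 3.

(* The part of the contribution of rho, counted with multiplicity, coming from
   the ordinates in A; the whole contribution is the case A = setT. *)
Definition contribution_on A phi t0 sigma rho : R :=
  (mult Xi rho)%:R * Re (cintegral A (term_integrand phi t0 sigma rho)).

Definition contribution phi t0 sigma rho : R :=
  contribution_on setT phi t0 sigma rho.

Definition reflect1 rho : R[i] := 1 - rho^*.

Definition pair_contribution phi t0 sigma rho : R :=
  contribution phi t0 sigma rho + contribution phi t0 sigma (reflect1 rho).

(* Each off-critical pair has exactly one member with real part > 1/2; a zero
   on the critical line is its own reflection. *)
Definition paired_sum Y phi t0 sigma : R :=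
  \sum_(rho \in zeros Xi Y `&` [set rho | 2^-1 < Re rho])
     pair_contribution phi t0 sigma rho +
  \sum_(rho \in zeros Xi Y `&` [set rho | Re rho = 2^-1])
     contribution phi t0 sigma rho.

End SecondDerivative.

(* Main.v *)
Require Import Defs.
From HB Require Import structures.
From mathcomp Require Import all_boot all_order all_algebra.
From mathcomp Require Import all_classical all_reals all_analysis.
From mathcomp Require Import complex ring.
Import Order.TTheory GRing.Theory Num.Theory.
Import numFieldNormedType.Exports.
Import complex.
Set Implicit Arguments.
Unset Strict Implicit.
Unset Printing Implicit Defensive.
Local Open Scope classical_set_scope.
Local Open Scope ring_scope.
Local Open Scope complex_scope.

(* Put s' = 1 - conj s.  The two symmetries of Xi give Xi s' = conj (Xi s), so
   s |-> s' permutes the zeros with |Im| <= Y and preserves multiplicities.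
   Since s' - rho' = - conj (s - rho), and s' = s on the critical line, the
   integrands attached to rho and rho' there have opposite real parts: pairs
   cancel, and a critical zero, being its own reflection, contributes 0.
   For the same reason M_Y (1 - sigma) = - M_Y sigma, so M_Y' is symmetric about
   1/2 and M_Y'' (1/2) = 0, the value of the paired sum. *)

(** * Odd and even functions on the real line *)

Section OddFunctions.
Context {R : realType}.
Implicit Types f : R -> R.

(* No integrability is needed: [fine] sends both infinities to [0]. *)
Lemma Rintegral_opp (A : set R) f :
  (\int[lebesgue_measure]_(t in A) (- f t) =
   - \int[lebesgue_measure]_(t in A) f t)%R.
Proof.
rewrite /Rintegral [in LHS]integralE [in RHS]integralE.
rewrite [X in (X^\+)%E](_ : _ = \- (EFin \o f))%E //.
rewrite [X in (X^\-)%E](_ : _ = \- (EFin \o f))%E //.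
rewrite funeposN funenegN.
by case: (integral _ _ _) => [x||]; case: (integral _ _ _) => [y||] //=;
  rewrite ?oppr0 // opprB.
Qed.

(** Negation preserves the filter [0^'], so both limits are taken along the same filter, convergent
    or not. *)
Lemma lim_comp_opp0 (f : R -> R) : lim (f (- h) @[h --> 0^']) = lim (f h @[h --> 0^']).
Proof.
suff -> : (f (- h) @[h --> 0^']) = (f h @[h --> 0^']) by [].
have E (P : set R) : (\forall h \near 0^', P (- h)) <-> \forall h \near 0^', P h.
  have imp (Q : set R) : (\forall h \near 0^', Q h) -> \forall h \near 0^', Q (- h).
    move=> nQ; have [S SQ <-] : ((fun A => -%R @` A) @` (0 : R)^') Q.
      by rewrite -dnbhsN oppr0.
    by apply: filterS SQ => h Sh; exists h.
  by split=> [/imp|/imp//]; apply: filterS => h /=; rewrite opprK.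
apply/seteqP; split=> P.
  exact: (E (f @^-1` P)).1.
exact: (E (f @^-1` P)).2.
Qed.

(* Where the derivative does not exist, both sides are the same default value. *)
Lemma derive1_odd_about c f (fN : forall x, f (c - x) = - f x) x :
  derive1 f (c - x) = derive1 f x.
Proof.
rewrite /derive1 -lim_comp_opp0.
congr (lim (_ @ 0^')); apply/funext => h.
have -> : - h + (c - x) = c - (h + x) by ring.
by rewrite !fN -opprD invrN scaleNr scalerN opprK.
Qed.

(* If the derivative does not exist, [derive1] takes the default value [0]. *)
Lemma derive1_even_about c f (fE : forall x, f (c - x) = f x) :
  derive1 f (c / 2) = 0.
Proof.
rewrite /derive1; set q := fun h => _.
(* The difference quotient at the centre is odd, so its limit, if any, equals its own negative. *)
have qN h : q (- h) = - q h.
  rewrite /q invrN scaleNr; congr (- (_ *: (_ - _))).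
  by rewrite -fE; congr f; field.
have [qcvg|/dvgP //] := pselect (cvg (q h @[h --> 0^'])).
have := lim_comp_opp0 q; under eq_fun do rewrite qN.
rewrite limN // => /eqP.
by rewrite eq_sym -addr_eq0 -mulr2n mulrn_eq0 /= => /eqP.
Qed.

End OddFunctions.

(** * The reflection s' = 1 - conj s and its action on zeros, [RY], [MY] and contributions *)

Section Reflection.
Context {R : realType}.
Implicit Types (s rho : R[i]) (f Xi : R[i] -> R[i]).

(* In [ring_scope], [^*] parses as [Num.conj], hence the explicit [conjc]. *)
Lemma reflect1_conjc rho : reflect1 rho = 1 - conjc rho.
Proof. by []. Qed.

Lemma conjc_divB (a x y : R[i]) :
  conjc ((- conjc a)^-1 * (x - y)) = - (a^-1 * (conjc x - conjc y)).
Proof. by rewrite rmorphM fmorphV rmorphB rmorphN /= conjcK invrN mulNr. Qed.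

Lemma divr_oppr_conjc (a : R) (z : R[i]) :
  a%:C / - conjc z = - conjc (a%:C / z).
Proof. by rewrite invrN mulrN rmorphM fmorphV /= oppr0. Qed.

Lemma reflect1E rho : reflect1 rho = (1 - Re rho) +i* Im rho.
Proof. by case: rho => a b; rewrite /reflect1; simpc. Qed.

Lemma reflect1K : involutive (@reflect1 R).
Proof. by move=> s; rewrite !reflect1E /= subKr; case: s. Qed.

Lemma subr_reflect1 s rho : reflect1 s - reflect1 rho = - conjc (s - rho).
Proof. by rewrite !reflect1_conjc rmorphB; ring. Qed.

(** Reflection is an isometry, so it respects balls. *)
Lemma nbhs_reflect1 (rho : R[i]) (P : set R[i]) :
  (\forall s \near (reflect1 rho : R[i]^o), P s) ->
  \forall s \near (rho : R[i]^o), P (reflect1 s).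
Proof.
move=> /nbhs_ballP[e e0 eP]; apply/nbhs_ballP; exists e => // s se.
by apply: eP; move: se; rewrite -!ball_normE /= subr_reflect1 normrN normcJ.
Qed.

Lemma continuous_conjc : continuous (conjc : R[i]^o -> R[i]^o).
Proof.
move=> s P /nbhs_ballP[e e0 eP]; apply/nbhs_ballP; exists e => // z ze.
by apply: eP; move: ze; rewrite -!ball_normE /= -rmorphB normcJ.
Qed.

(** The difference quotient of conj (g s') with increment h is minus the conjugate of that of [g]
    with increment - conj h. *)
Lemma derivable_conjc_reflect1 (g : R[i]^o -> R[i]^o) (rho : R[i]^o) :
  derivable g (reflect1 rho : R[i]^o) 1 ->
  derivable (fun s : R[i]^o => conjc (g (reflect1 s)) : R[i]^o) rho 1.
Proof.
move=> dg; rewrite /derivable.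
pose q (h : R[i]^o) : R[i]^o := h^-1 *: (g (h *: 1 + reflect1 rho) - g (reflect1 rho)).
have [l ql] : exists l : R[i]^o, q h @[h --> 0^'] --> l by apply/cvg_ex.
pose c (h : R[i]^o) : R[i]^o := - conjc h.
have cq h : h^-1 *: (conjc (g (reflect1 (h *: 1 + rho))) - conjc (g (reflect1 rho))) =
    - conjc (q (c h)) :> R[i]^o.
  rewrite /q /c /GRing.scale /= !mulr1.
  have -> : reflect1 (h + rho) = - conjc h + reflect1 rho.
    by rewrite !reflect1_conjc rmorphD /=; ring.
  by rewrite conjc_divB opprK.
have c0 : c h @[h --> 0^'] --> (0 : R[i]^o)^'.
  move=> P /= [e e0 eP]; exists e => // h he h0; apply: eP.
    by move: he; rewrite /c /ball_ /= !sub0r !normrN normcJ.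
  by rewrite /c oppr_eq0 conjc_eq0.
apply/cvg_ex; exists (- conjc l : R[i]^o).
apply: (@cvg_trans _ ((fun h => - conjc (q (c h)) : R[i]^o) @ 0^')).
  by apply: near_eq_cvg; apply: nearW => h; exact/esym/cq.
apply: (@cvgN _ R[i]^o); apply: continuous_cvg; first exact: continuous_conjc.
exact: cvg_comp c0 ql.
Qed.

Lemma has_order_reflect1 Xi rho n
    (Xi_refl : forall s, Xi (reflect1 s) = conjc (Xi s)) :
  has_order Xi (reflect1 rho) n -> has_order Xi rho n.
Proof.
move=> [g [dg g0 Xig]].
(* Conjugate the factorization at rho'; the factor (-1)^n absorbs the sign in s' - rho' = - conj (s
   - rho). *)
exists ((-1) ^+ n \*: (fun s => conjc (g (reflect1 s)) : R[i]^o)); split.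
- apply: filterS (nbhs_reflect1 dg) => s dgs.
  exact/derivableZ/derivable_conjc_reflect1.
- by rewrite mulf_neq0 ?conjc_eq0 // signr_eq0.
- apply: filterS (nbhs_reflect1 Xig) => s Xis.
  rewrite -[Xi s]conjcK -Xi_refl Xis.
  rewrite subr_reflect1 rmorphM rmorphXn rmorphN /= conjcK -mulN1r exprMn.
  by rewrite /GRing.scale /= mulrCA mulrA.
Qed.

(** As reflection is an involution, both points admit the same set of orders, and [xget] depends
    only on that set. *)
Lemma mult_reflect1 Xi rho
    (Xi_refl : forall s, Xi (reflect1 s) = conjc (Xi s)) :
  mult Xi (reflect1 rho) = mult Xi rho.
Proof.
rewrite /mult; congr xget; apply/seteqP; split=> n /=.
  exact: has_order_reflect1.
by rewrite -{1}[rho]reflect1K; apply: has_order_reflect1.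
Qed.

Lemma zeros_reflect1 Xi Y rho
    (Xi_refl : forall s, Xi (reflect1 s) = conjc (Xi s)) :
  zeros Xi Y rho -> zeros Xi Y (reflect1 rho).
Proof. by move=> [Xi0 rhoY]; split; rewrite ?Xi_refl ?Xi0 ?conjc0 ?reflect1E. Qed.

(** Conjugation vanishes only at 0, so both families have the same support; if it is infinite, both
    sums default to 0. *)
Lemma conjc_fsum (I : choiceType) (A : set I) (F : I -> R[i]) :
  \sum_(i \in A) conjc (F i) = conjc (\sum_(i \in A) F i).
Proof.
have -> : finite_support 0 A (fun i => conjc (F i)) = finite_support 0 A F.
  rewrite /finite_support !unlock; congr (_ (fset_set (_ `&` _))).
  apply/seteqP; split=> i /= + Fi0; apply.
    by rewrite Fi0 conjc0.
  by rewrite -[LHS]conjcK Fi0 conjc0.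
by rewrite [RHS]rmorph_sum.
Qed.

Lemma RY_reflect1 Xi Y s
    (Xi_refl : forall s, Xi (reflect1 s) = conjc (Xi s)) :
  RY Xi Y (reflect1 s) = - conjc (RY Xi Y s).
Proof.
have reflect_bij : set_bij (zeros Xi Y) (zeros Xi Y) (@reflect1 R).
  split=> [rho|rho rho' _ _|rho rhoZ]; first exact: zeros_reflect1.
    exact: (inv_inj reflect1K).
  by exists (reflect1 rho); [exact: zeros_reflect1 | rewrite reflect1K].
rewrite /RY (reindex_fsbig _ _ _ _ reflect_bij) -mulN1r -conjc_fsum mulr_fsumr.
apply: eq_fsbigr => rho _.
rewrite mult_reflect1 // subr_reflect1 invrN mulrN mulN1r.
by rewrite rmorphM fmorphV rmorph_nat.
Qed.

Lemma MY_odd_about Xi Y phi t0 (sigma : R)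
    (Xi_refl : forall s, Xi (reflect1 s) = conjc (Xi s)) :
  MY Xi Y phi t0 (1 - sigma) = - MY Xi Y phi t0 sigma.
Proof.
rewrite /MY -Rintegral_opp; apply: eq_Rintegral => t _.
have -> : (1 - sigma) +i* t = reflect1 (sigma +i* t) by rewrite reflect1E.
by rewrite RY_reflect1 // -mulrN; case: (RY _ _ _).
Qed.

(** On the critical line s' = s, so s - rho' = - conj (s - rho); the odd power 3 keeps this sign,
    and the numerator is real. *)
Lemma Re_term_integrand_reflect1 phi t0 rho t :
  Re (term_integrand phi t0 2^-1 (reflect1 rho) t) =
  - Re (term_integrand phi t0 2^-1 rho t).
Proof.
have half : 2^-1 +i* t = reflect1 (2^-1 +i* t).
  by rewrite reflect1E /=; congr (_ +i* _); field.
rewrite /term_integrand {1}half subr_reflect1.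
set z := (2^-1 +i* t) - rho; move: (2 * _) => a.
have -> : (- conjc z) ^+ 3 = - conjc (z ^+ 3) by rewrite rmorphXn /=; ring.
by rewrite divr_oppr_conjc; case: (_ / _).
Qed.

Lemma pair_contribution_eq0 Xi phi t0 rho
    (Xi_refl : forall s, Xi (reflect1 s) = conjc (Xi s)) :
  pair_contribution Xi phi t0 2^-1 rho = 0.
Proof.
rewrite /pair_contribution /contribution /contribution_on mult_reflect1 //.
rewrite /cintegral /=.
under [X in _ + _ * X]eq_Rintegral do rewrite Re_term_integrand_reflect1.
by rewrite Rintegral_opp mulrN subrr.
Qed.

(* At [t = Im rho] this holds because division by zero gives [0]. *)
Lemma Re_term_integrand_critical phi t0 rho t : Re rho = 2^-1 ->
  Re (term_integrand phi t0 2^-1 rho t) = 0.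
Proof.
move=> rho2; have rhoE : reflect1 rho = rho.
  by rewrite reflect1E rho2; case: rho rho2 => a b /= ->; congr (_ +i* _); field.
have := Re_term_integrand_reflect1 phi t0 rho t; rewrite rhoE => /eqP.
by rewrite -addr_eq0 -mulr2n mulrn_eq0 /= => /eqP.
Qed.

Lemma contribution_on_critical Xi A phi t0 rho : Re rho = 2^-1 ->
  contribution_on Xi A phi t0 2^-1 rho = 0.
Proof.
move=> rho2; rewrite /contribution_on /cintegral /=.
under eq_Rintegral do rewrite Re_term_integrand_critical //.
by rewrite /Rintegral integral0 mulr0.
Qed.

End Reflection.

Theorem proposition5p4 (R : realType) (Xi : R[i] -> R[i])
  (hXi : completed_zeta Xi)
  (hXi_fe : forall s : R[i], Xi s = Xi (1 - s))
  (hXi_conj : forall s : R[i], Xi s^* = (Xi s)^*)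
  (phi : R -> R) (hphi : schwartz phi) (hphi_even : forall x : R, phi (- x) = phi x)
  (t0 Y : R) (hY : 0 < Y) :
  [/\ (* the paired formula *)
      (forall rho : R[i], zeros Xi Y rho -> Re rho = 2^-1 ->
         ~ supp (translate phi t0) (Im rho)) ->
      derive1n 2 (MY Xi Y phi t0) 2^-1 = paired_sum Xi Y phi t0 2^-1,
      (* off-critical pairs *)
      forall rho : R[i], zeros Xi Y rho -> Re rho != 2^-1 ->
        pair_contribution Xi phi t0 2^-1 rho = 0 &
      (* zeros on the critical line, away from their singular ordinate *)
      forall rho : R[i], zeros Xi Y rho -> Re rho = 2^-1 ->
        [/\ forall t : R, t != Im rho ->
              Re (term_integrand phi t0 2^-1 rho t) = 0,
            forall A : set R, measurable A -> ~ closure A (Im rho) ->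
              contribution_on Xi A phi t0 2^-1 rho = 0 &
            ~ supp (translate phi t0) (Im rho) ->
              contribution Xi phi t0 2^-1 rho = 0]].
Proof.
have Xi_refl s : Xi (reflect1 s) = conjc (Xi s) by rewrite -hXi_fe hXi_conj.
split=> [_|rho _ _|rho _ rho2].
(* Both sums vanish term by term, which leaves M_Y'' (1/2) = 0. *)
- rewrite /paired_sum !fsbig1 => [|rho [_ rho2]|rho _].
  + rewrite addr0; set M := MY Xi Y phi t0.
    have M'E x : derive1 M (1 - x) = derive1 M x.
      by apply: derive1_odd_about => y; exact: MY_odd_about.
    (* [derive1n 2 M] unfolds to the derivative of [derive1 M], taken here at the centre of symmetry
       1 / 2. *)
    by have := derive1_even_about M'E; rewrite div1r.
  + exact: contribution_on_critical.
  + exact: pair_contribution_eq0.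
- exact: pair_contribution_eq0.
- split=> [t _|A _ _|_].
  + exact: Re_term_integrand_critical.
  + exact: contribution_on_critical.
  + exact: contribution_on_critical.
Qed.
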